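(* Let $A, B, C$ be integers such that $A, B, C, ABC$ are distinct square-free non-zero integers, and suppose $L = \mathbb{Q}(\sqrt{A}, \sqrt{B}, \sqrt{C})$ is a triquadratic number field (i.e. $[L:\mathbb{Q}] = 8$). Let $v \in L$ with $[L : \mathbb{Q}(v)] = 4$. Then there exists a primitive element $\alpha$ of $L$ such that $$\deg_\alpha(v) = [L : \mathbb{Q}(v)] = 4.$$
   Context: A primitive element of a number field $L$ of degree $n$ is an $\alpha \in L$ with $\mathbb{Q}(\alpha) = L$. For such $\alpha$, every $v \in L$ can be written uniquely as $v = f(\alpha)$ with $f \in \mathbb{Q}[x]$, $\deg f \leq n-1$; the degree of $v$ with respect to $\alpha$, $\deg_\alpha(v)$, is $\deg f$. *)

(* Defs.v *)
From HB Require Import structures.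
From mathcomp Require Import all_boot all_order all_algebra all_field.

Set Implicit Arguments.
Unset Strict Implicit.
Unset Printing Implicit Defensive.

Import Order.TTheory GRing.Theory Num.Theory.
Local Open Scope ring_scope.

Definition squarefree_int (n : int) : Prop :=
  forall d : int, (d ^+ 2 %| n)%Z -> `|d|%N = 1%N.

Definition primitive_elt (L : fieldExtType rat) (alpha : L) : Prop :=
  <<1; alpha>>%VS = {:L}%VS.

(* [Fadjoin_poly 1 alpha v] has its coefficients in the base field 1%VS and
   size at most [Q(alpha) : Q]; see [deg_wrtP] below.
   Convention: [deg_wrt alpha 0 = 0]. *)
Definition deg_wrt (L : fieldExtType rat) (alpha v : L) : nat :=
  (size (Fadjoin_poly 1%VS alpha v)).-1.

Lemma deg_wrtP (L : fieldExtType rat) (alpha v : L) :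
  primitive_elt alpha ->
  exists2 f : {poly rat},
    unique (fun g : {poly rat} => (size g <= \dim {:L})%N
                     /\ v = (map_poly (in_alg L) g).[alpha]) f
    & deg_wrt alpha v = (size f).-1.
Proof.
move=> prim_a.
have dimE : adjoin_degree 1 alpha = \dim {:L}.
  by rewrite /adjoin_degree prim_a dimv1 divn1 prednK // adim_gt0.
have va : v \in <<1; alpha>>%VS by rewrite prim_a memvf.
have /polyOver1P[f Df] := Fadjoin_polyOver 1 alpha v.
exists f; last by rewrite /deg_wrt Df size_map_poly.
split; first split.
- by rewrite -dimE -(size_map_poly (in_alg L)) -Df size_Fadjoin_poly.
- by rewrite -Df Fadjoin_poly_eq.
move=> g [szg Dv]; apply: (map_poly_inj (in_alg L)); rewrite -Df.
apply: Fadjoin_poly_unique => //; first by apply/polyOver1P; exists g.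
by rewrite size_map_poly dimE.
Qed.

(* Main.v *)
Require Import Defs.
From HB Require Import structures.
From mathcomp Require Import all_boot all_order all_algebra all_field ring.

Set Implicit Arguments.
Unset Strict Implicit.
Unset Printing Implicit Defensive.

Import Order.TTheory GRing.Theory Num.Theory.
Local Open Scope ring_scope.

(** Completing the square, [v = w + c] with [c] and [D = w ^+ 2] rational, and
    two of the three given square roots, say [p] and [q] with squares [P] and
    [Q], generate [L] over [Q(w)].  The witness is
      [alpha = x * p + y * q]   with [x = Q + w] and [y = w - P].
    The irrational parts of [x ^+ 2 * P] and [y ^+ 2 * Q] are [2 * P * Q * w] and
    [- 2 * P * Q * w], so [s = x ^+ 2 * P + y ^+ 2 * Q] is rational, and
      [alpha ^+ 4 - 2 * s * alpha ^+ 2 + (x ^+ 2 * P - y ^+ 2 * Q) ^+ 2 = 0].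
    Here [x ^+ 2 * P - y ^+ 2 * Q = m + 4 * P * Q * w] where
    [m = (Q - P) * (P * Q - D)] is nonzero, so the constant term of this quartic
    over [Q(w)] is not rational, and solving for it expresses [w] as a polynomial
    of degree 4 in [alpha].  Then [alpha ^+ 2] yields [p * q], and [p] and [q]
    follow by solving the linear system given by [alpha] and [alpha * p * q]. *)

Lemma adjoin_degree_sqrt_le (F : fieldType) (L : fieldExtType F)
    (K : {subfield L}) (x : L) :
  x ^+ 2 \in K -> (adjoin_degree K x <= 2)%N.
Proof.
move=> Kx2; rewrite -ltnS -size_minPoly -(size_XnsubC (x ^+ 2) (ltn0Sn 1)).
apply: dvdp_leq; first by rewrite -size_poly_eq0 size_XnsubC.
apply: minPoly_dvdp; first by rewrite rpredB ?polyOverXn ?polyOverC.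
by rewrite rootE !hornerE subrr.
Qed.

Lemma dim_adjoin_sqrt_le (F : fieldType) (L : fieldExtType F)
    (K : {subfield L}) (x : L) :
  x ^+ 2 \in K -> (\dim <<K; x>> <= 2 * \dim K)%N.
Proof.
by move=> Kx2; rewrite dim_Fadjoin leq_mul2r adjoin_degree_sqrt_le ?orbT.
Qed.

(** Generation is stated as membership of [w], [p], [q] in [<<1; alpha>>], so no dimension count
    enters the computation. *)
Lemma quartic_generator (F : fieldType) (L : fieldExtType F) (w p q : L) :
    (2 : L) != 0 ->
    w ^+ 2 \in 1%VS -> p ^+ 2 \in 1%VS -> q ^+ 2 \in 1%VS ->
    w \notin 1%VS -> p \notin <<1; w>>%VS -> q \notin <<<<1; w>>; p>>%VS ->
  exists alpha : L, exists f : {poly L},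
    [/\ {subset [:: w; p; q] <= <<1; alpha>>%VS},
        f \is a polyOver 1%VS, size f = 5%N & f.[alpha] = w].
Proof.
move=> nz2 w2 p2 q2 nw np nq.
have K1 (K : {subfield L}) x : x \in 1%VS -> x \in K.
  by move=> x1; apply: (subvP (sub1v K)).
have nzp : p != 0 by apply: contraNneq np => ->; rewrite mem0v.
have nzq : q != 0 by apply: contraNneq nq => ->; rewrite mem0v.
(* Kept opaque so that the closure lemmas do not unfold the squares. *)
have [[D DE] [P PE] [Q QE]] : [/\ exists D, D = w ^+ 2,
    exists P, P = p ^+ 2 & exists Q, Q = q ^+ 2] by split; eexists.
rewrite -DE in w2; rewrite -PE in p2; rewrite -QE in q2.
(* Otherwise [q = p] or [q = - p]; likewise [P * Q = D] would make [p * q] equal to [w] or [- w].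
   Both put [q] in [<<<<1; w>>; p>>]. *)
have nPQ : Q - P != 0.
  rewrite subr_eq0 PE QE eqf_sqr; apply: contra nq.
  by case/orP=> /eqP->; rewrite ?rpredN memv_adjoin.
have nPQD : P * Q - D != 0.
  rewrite subr_eq0 PE QE DE -exprMn eqf_sqr; apply: contra nq => pqw.
  have -> : q = p^-1 * (p * q) by rewrite mulKf.
  rewrite rpredM ?rpredV ?memv_adjoin //.
  have Kw : w \in <<<<1; w>>; p>>%VS.
    by rewrite (subvP (subv_adjoin _ _)) // memv_adjoin.
  by case/orP: pqw => /eqP->; rewrite ?rpredN.
have affine_neq0 a b : a \in 1%VS -> b \in 1%VS -> b != 0 -> a + b * w != 0.
  move=> a1 b1 nzb; apply: contra nw; rewrite addr_eq0 => /eqP ab.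
  have -> : w = b^-1 * - a by rewrite ab opprK mulKf.
  by rewrite rpredM ?rpredV ?rpredN.
have nzx : Q + w != 0 by rewrite -[w]mul1r affine_neq0 ?oner_eq0 ?mem1v.
have nzy : w - P != 0.
  by rewrite addrC -[w]mul1r affine_neq0 ?oner_eq0 ?mem1v ?rpredN.
have nzPQ : P * Q != 0 by rewrite mulf_neq0 ?PE ?QE ?expf_neq0.
pose m := (Q - P) * (P * Q - D).
have nzm : m != 0 by rewrite mulf_neq0.
have m1 : m \in 1%VS by rewrite rpredM ?rpredB ?rpredM.
have n1 n : n%:R \in (1%VS : {vspace L}) by rewrite rpred_nat.
have nz4 : (4 : L) != 0 by rewrite (natrM _ 2 2) mulf_neq0.
have nz8 : (8 : L) != 0 by rewrite (natrM _ 4 2) mulf_neq0.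
have nz4PQ : 4 * (P * Q) != 0 by rewrite mulf_neq0.
have PQ1 : 4 * (P * Q) \in 1%VS by rewrite !rpredM.
have nzdiff := affine_neq0 _ _ m1 PQ1 nz4PQ.
pose al := (Q + w) * p + (w - P) * q.
pose s := (Q ^+ 2 + D) * P + (P ^+ 2 + D) * Q.
(* [c + k * w] is the expansion of [(m + 4 * (P * Q) * w) ^+ 2], with [w ^+ 2] replaced by [D]. *)
pose c := m ^+ 2 + 16 * (P * Q) ^+ 2 * D.
pose k := 8 * (P * Q) * m.
have nzk : k != 0 by rewrite mulf_neq0 // mulf_neq0.
have k1 : k \in 1%VS by rewrite rpredM // rpredM // rpredM.
have s1 : s \in 1%VS by rewrite rpredD // rpredM // rpredD // rpredX.
have c1 : c \in 1%VS by rewrite rpredD ?rpredX // !rpredM.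
have quartic : al ^+ 4 - 2 * s * al ^+ 2 + c + k * w = 0.
  by rewrite /al /s /c /k /m DE PE QE; ring.
pose f : {poly L} := - k^-1 *: ('X^4 - (2 * s) *: 'X^2 + c%:P).
have fal : f.[al] = w.
  rewrite /f !(hornerZ, hornerD, hornerN, hornerC, hornerXn).
  apply: (mulfI nzk); rewrite mulrA mulrN mulfV // mulN1r.
  by apply/esym/eqP; rewrite -addr_eq0 addrC quartic.
have f1 : f \is a polyOver 1%VS.
  by rewrite polyOverZ ?rpredN ?rpredV // rpredD ?polyOverC // rpredB
    ?polyOverXn // polyOverZ ?polyOverXn // rpredM.
have szf : size f = 5%N.
  rewrite size_scale ?oppr_eq0 ?invr_eq0 // -addrA size_polyDl size_polyXn //.
  rewrite (leq_ltn_trans (size_polyD _ _)) // gtn_max size_polyN.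
  rewrite (leq_ltn_trans (size_scale_leq _ _)) ?size_polyXn //.
  by rewrite (leq_ltn_trans (size_polyC_leq1 _)).
exists al, f; split=> //.
set E := <<1; al>>%VS.
have Eal : al \in E by apply: memv_adjoin.
have Ew : w \in E.
  rewrite -fal; apply: rpred_horner => //.
  by apply: polyOverS f1 => x; apply: K1.
have EP : P \in E by apply: K1.
have EQ : Q \in E by apply: K1.
have E2 : 2 \in E by rewrite rpred_nat.
have Ex : Q + w \in E by apply: rpredD.
have Ey : w - P \in E by apply: rpredB.
have Epq : p * q \in E.
  have -> : p * q = (al ^+ 2 - ((Q + w) ^+ 2 * P + (w - P) ^+ 2 * Q))
                    / (2 * (Q + w) * (w - P)).
    apply: (mulIf (mulf_neq0 (mulf_neq0 nz2 nzx) nzy)).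
    by rewrite divfK ?mulf_neq0 // /al PE QE; ring.
  apply: rpred_div; last by rewrite rpredM // rpredM.
  by rewrite rpredB ?rpredX // rpredD // rpredM // rpredX.
have Ediff : m + 4 * (P * Q) * w \in E.
  by apply: rpredD; [exact: K1 | apply: rpredM => //; exact: K1].
have Ep : p \in E.
  (* Cramer's rule for [x * p + y * q = al] and [y * Q * p + x * P * q = p * q * al]; the
     determinant is [x ^+ 2 * P - y ^+ 2 * Q]. *)
  have -> : p = ((Q + w) * P * al - (w - P) * (p * q) * al)
                / (m + 4 * (P * Q) * w).
    apply: (mulIf nzdiff); rewrite divfK //.
    by rewrite /al /m DE PE QE; ring.
  by rewrite rpred_div // rpredB // rpredM // rpredM.
have Eq : q \in E.
  have -> : q = (al - (Q + w) * p) / (w - P).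
    by apply: (mulIf nzy); rewrite divfK // /al; ring.
  by rewrite rpred_div // rpredB // rpredM.
by move=> x; rewrite !inE => /or3P[] /eqP->.
Qed.

(** Adjoining one square root at most doubles the dimension, so no [<<K; x>>] with [x ^+ 2] in [K]
    contains all three generators. Hence at most one of them is redundant. *)
Lemma pick_two_sqrts (F : fieldType) (L : fieldExtType F)
    (K : {subfield L}) (a b c : L) :
    a ^+ 2 \in K -> b ^+ 2 \in K -> c ^+ 2 \in K ->
    <<K & [:: a; b; c]>>%VS = {:L}%VS -> \dim {:L} = (4 * \dim K)%N ->
  exists p q : L, [/\ p \in [:: a; b; c], q \in [:: a; b; c],
    p \notin K & q \notin <<K; p>>%VS].
Proof.
move=> a2 b2 c2 genL dimL.
have not_sub x : x ^+ 2 \in K -> ~ {subset [:: a; b; c] <= <<K; x>>%VS}.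
  move=> x2 sub; have /dimvS : ({:L} <= <<K; x>>)%VS.
    by rewrite -genL; apply/Fadjoin_seqP; split; first exact: subv_adjoin.
  rewrite dimL => /leq_trans/(_ (dim_adjoin_sqrt_le x2)).
  by rewrite leq_pmul2r ?adim_gt0.
have KE x y : y \in K -> y \in <<K; x>>%VS by apply/subvP/subv_adjoin.
have [Ka | nKa] := boolP (a \in K).
  exists b, c; split; rewrite ?inE ?eqxx ?orbT //; apply/negP => K'.
    by apply: (not_sub c) => // x /[!inE]/or3P[] /eqP->;
      first [exact: memv_adjoin | exact: KE | done].
  by apply: (not_sub b) => // x /[!inE]/or3P[] /eqP->;
    first [exact: memv_adjoin | exact: KE | done].
have [Kb | nKb] := boolP (b \in <<K; a>>%VS).
  exists a, c; split; rewrite ?inE ?eqxx ?orbT //; apply/negP => Kc.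
  by apply: (not_sub a) => // x /[!inE]/or3P[] /eqP->;
    first [exact: memv_adjoin | exact: KE | done].
by exists a, b; split; rewrite ?inE ?eqxx ?orbT.
Qed.

Lemma adjoin_notin_dim_ge (F : fieldType) (L : fieldExtType F)
    (K : {subfield L}) (x : L) :
  x \notin K -> (2 * \dim K <= \dim <<K; x>>)%N.
Proof.
move=> nKx; have nd1 : adjoin_degree K x != 1%N by rewrite [_ == _]adjoin_deg_eq1.
by rewrite dim_Fadjoin leq_mul // ltn_neqAle eq_sym nd1.
Qed.

Lemma complete_square (F : fieldType) (L : fieldExtType F) (v : L) :
    (2 : L) != 0 -> \dim <<1; v>> = 2%N ->
  exists2 c, c \in 1%VS & (v - c) ^+ 2 \in 1%VS.
Proof.
move=> nz2 dimv.
have sz : size (minPoly 1 v) = 3%N.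
  by rewrite size_minPoly; congr _.+1; rewrite -dimv dim_Fadjoin dimv1 muln1.
have /polyOverP co := minPolyOver 1%AS v.
have := monicP (monic_minPoly 1 v); rewrite /lead_coef sz /= => lead1.
have := rootP (root_minPoly 1%AS v); rewrite horner_coef sz !big_ord_recl big_ord0.
rewrite /= /bump /= lead1 => rt.
exists (- (minPoly 1 v)`_1 / 2); first by rewrite rpred_div ?rpredN ?rpred_nat.
(* The two sides differ by the minimal polynomial evaluated at [v], which vanishes by [rt]. *)
have -> : (v - - (minPoly 1 v)`_1 / 2) ^+ 2
          = ((minPoly 1 v)`_1 / 2) ^+ 2 - (minPoly 1 v)`_0.
  apply/eqP; rewrite -subr_eq0 -[X in _ == X]rt; apply/eqP; field.
  exact: nz2.
by rewrite rpredB ?rpredX ?rpred_div ?rpred_nat.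
Qed.

Theorem theorem4p1 (A B C : int)
    (distinct : uniq [:: A; B; C; A * B * C])
    (nonzero : [/\ A != 0, B != 0, C != 0 & A * B * C != 0])
    (sqfree : [/\ squarefree_int A, squarefree_int B, squarefree_int C
                & squarefree_int (A * B * C)])
    (L : fieldExtType rat) (sqrtA sqrtB sqrtC : L)
    (sqrtAE : sqrtA ^+ 2 = A%:~R) (sqrtBE : sqrtB ^+ 2 = B%:~R)
    (sqrtCE : sqrtC ^+ 2 = C%:~R)
    (genL : <<1 & [:: sqrtA; sqrtB; sqrtC]>>%VS = {:L}%VS)
    (degL : \dim {:L} = 8%N)
    (v : L) (degv : \dim_<<1; v>> {:L} = 4%N) :
  exists alpha : L,
    [/\ primitive_elt alpha,
        deg_wrt alpha v = \dim_<<1; v>> {:L}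
      & \dim_<<1; v>> {:L} = 4%N].
Proof.
have nz2 : (2 : L) != 0.
  have -> : (2 : L) = 2%:A by rewrite scaler_nat.
  by rewrite scaler_eq0 oner_eq0.
have int1 (n : int) : (n%:~R : L) \in 1%VS by rewrite rpred_int.
have sub1 (K : {subfield L}) x : x \in 1%VS -> x \in K.
  by move=> x1; apply: (subvP (sub1v K)).
have dimv : \dim <<1; v>> = 2%N.
  apply/eqP; rewrite -(eqn_pmul2l (ltn0Sn 3)) -{1}degv.
  by rewrite -dim_sup_field ?subvf // degL.
have [c c1 w2] := complete_square nz2 dimv; set w := v - c in w2.
(* A rational [w] would make [v = w + c] rational. *)
have nw : w \notin 1%VS.
  apply: contraTN isT => w1.
  have /dimvS : (<<1; v>> <= 1%AS)%VS.
    by apply/FadjoinP; split=> //; rewrite -(subrK c v) rpredD.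
  by rewrite dimv dimv1.
have dimw : \dim <<1; w>> = 2%N.
  apply/anti_leq; have := @adjoin_notin_dim_ge _ _ 1%AS w nw.
  by have := @dim_adjoin_sqrt_le _ _ 1%AS w w2; rewrite dimv1 muln1 => -> ->.
have genLw : <<<<1; w>> & [:: sqrtA; sqrtB; sqrtC]>>%VS = {:L}%VS.
  apply/eqP; rewrite eqEsubv subvf /= -genL.
  apply/Fadjoin_seqP; split; first exact: sub1v.
  exact: seqv_sub_adjoin.
have [||||p [q [pS qS np nq]]] := pick_two_sqrts _ _ _ genLw.
- by rewrite sqrtAE sub1.
- by rewrite sqrtBE sub1.
- by rewrite sqrtCE sub1.
- by rewrite degL dimw.
have sq1 x : x \in [:: sqrtA; sqrtB; sqrtC] -> x ^+ 2 \in 1%VS.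
  by rewrite !inE => /or3P[] /eqP->; rewrite (sqrtAE, sqrtBE, sqrtCE).
have [al [f [sub f1 szf fal]]] :=
  quartic_generator nz2 w2 (sq1 p pS) (sq1 q qS) nw np nq.
have prim : primitive_elt al.
  apply/eqP; rewrite eqEdim subvf degL /=.
  (* Each of the three adjunctions at least doubles the dimension, so this tower already has
     dimension 8. *)
  have /dimvS : (<<<<<<1; w>>; p>>; q>> <= <<1; al>>)%VS.
    apply/FadjoinP; split; last by rewrite sub ?inE ?eqxx ?orbT.
    apply/FadjoinP; split; last by rewrite sub ?inE ?eqxx ?orbT.
    apply/FadjoinP; split; last by rewrite sub ?inE ?eqxx ?orbT.
    exact: sub1v.
  apply: leq_trans; apply: leq_trans (adjoin_notin_dim_ge nq).
  rewrite -[8%N]/(2 * 4)%N leq_mul2l /=.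
  by apply: leq_trans (adjoin_notin_dim_ge np); rewrite dimw.
exists al; split=> //; rewrite degv /deg_wrt.
(* Since [v = w + c], the polynomial [f + c%:P] takes the value [v] at [al]. The constant leaves its
   size at 5, below the bound 8 under which such a representative is unique. *)
rewrite (@Fadjoin_poly_unique _ _ _ _ (f + c%:P)).
- by rewrite size_polyDl szf // (leq_ltn_trans (size_polyC_leq1 _)).
- by rewrite rpredD ?polyOverC.
- rewrite size_polyDl szf ?(leq_ltn_trans (size_polyC_leq1 _)) //.
  have := dim_Fadjoin 1%AS al; rewrite dimv1 muln1 => <-.
  by rewrite prim degL.
by rewrite !hornerE fal subrK.
Qed.
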